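(* For every $A\in\mathbb{M}_n$, $$\|A\|_1=\sup\Big\{\sum_{i=1}^k\|C_iAC_i^*\|_\infty : k\in\mathbb{N},\ C_1,\dots,C_k\in\mathbb{M}_n,\ \sum_{i=1}^k C_i^*C_i=I\Big\},$$ and the trace norm $\|\cdot\|_1$ is the minimum element of the class of $L$-norms $\||\cdot\||$ on $\mathbb{M}_n$ satisfying $\|\cdot\|_\infty\le\||\cdot\||$.
   Context: $\mathbb{M}_n$ is the algebra of complex $n\times n$ matrices with identity $I$; $\|\cdot\|_\infty$ is the operator norm and $\|A\|_1=\mathrm{Tr}(|A|)$ the trace norm. A norm $\||\cdot\||$ on $\mathbb{M}_n$ is an $L$-norm if $\sum_{i=1}^k\||C_iXC_i^*\||\le\||X\||$ for all $k$, all $X$ and all $C_i$ with $\sum_{i=1}^k C_i^*C_i=I$. Inequalities between norms are pointwise. *)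

(* Defs.v *)
From HB Require Import structures.
From mathcomp Require Import all_boot all_order all_algebra.
From mathcomp Require Import sesquilinear spectral.
From mathcomp Require Import complex.
From mathcomp Require Import all_classical all_reals.

Set Implicit Arguments.
Unset Strict Implicit.
Unset Printing Implicit Defensive.

Import Order.TTheory GRing.Theory Num.Theory.
Local Open Scope ring_scope.
Local Open Scope sesquilinear_scope.

Section Norms.
Variable R : realType.
Local Notation C := R[i].

Definition adj {m n} (A : 'M[C]_(m, n)) : 'M[C]_(n, m) := A ^t*.

Definition vnorm {n} (x : 'cV[C]_n) : R :=
  Num.sqrt (complex.Re ((adj x *m x) 0 0)).

Definition opnorm {n} (A : 'M[C]_n) : R :=
  sup [set vnorm (A *m x) | x in [set x : 'cV[C]_n | vnorm x = 1]]%classic.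

(* positive semidefinite: x^* P x >= 0 for all x (order of C: real and >= 0) *)
Definition psdmx {n} (P : 'M[C]_n) : Prop :=
  forall x : 'cV[C]_n, 0 <= (adj x *m P *m x) 0 0.

(* |A| = (A^* A)^{1/2}: the (unique) positive semidefinite square root of A^* A *)
Definition absmx {n} (A : 'M[C]_n) : 'M[C]_n :=
  xget 0 [set P : 'M[C]_n | psdmx P /\ P *m P = adj A *m A]%classic.

Definition trnorm {n} (A : 'M[C]_n) : R := complex.Re (\tr (absmx A)).

Definition is_norm {n} (N : 'M[C]_n -> R) : Prop :=
  [/\ forall X, 0 <= N X,
      forall X, N X = 0 -> X = 0,
      forall (c : C) X, N (c *: X) = complex.Re `|c| * N X
    & forall X Y, N (X + Y) <= N X + N Y].

Definition is_Lnorm {n} (N : 'M[C]_n -> R) : Prop :=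
  is_norm N /\
  forall (k : nat) (Cs : 'I_k -> 'M[C]_n) (X : 'M[C]_n),
    \sum_(i < k) adj (Cs i) *m Cs i = 1%:M ->
    \sum_(i < k) N (Cs i *m X *m adj (Cs i)) <= N X.

End Norms.

(* Main.v *)
(* The trace norm is dual to contractions: ||A||_1 is the maximum of Re Tr(W A)
   over contractions W, attained at a unitary U coming from the polar
   decomposition of A.  The triangle inequality follows, as does the L-norm
   inequality, because \sum_i C_i^* W_i C_i is a contraction when the W_i are
   and \sum_i C_i^* C_i = I.  Conversely, let (e_k) be an orthonormal eigenbasis
   of U with eigenvalues d_k, and C_k = e_k e_k^*.  Then \sum_k C_k^* C_k = I and
   ||A||_1 = Re \sum_k d_k <A e_k, e_k> <= \sum_k |<A e_k, e_k>|
           <= \sum_k ||C_k A C_k^*||_oo,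
   so every L-norm dominating the operator norm dominates the trace norm. *)

Require Import Defs.
From HB Require Import structures.
From mathcomp Require Import all_boot all_order all_algebra.
From mathcomp Require Import sesquilinear spectral.
From mathcomp Require Import complex.
From mathcomp Require Import all_classical all_reals.
From mathcomp Require Import ereal ring lra zify.
Import Order.TTheory GRing.Theory Num.Theory.
Local Open Scope ring_scope.

Set Implicit Arguments.
Unset Strict Implicit.
Unset Printing Implicit Defensive.

(** * Algebra of adjoints and of real parts *)

Section Adjoint.
Context {R : realType}.
Local Notation C := R[i].
Implicit Types m n p : nat.

Lemma adjmxE m n (A : 'M[C]_(m, n)) i j : adj A i j = (A j i)^*%R.
Proof. by rewrite /adj !mxE. Qed.

Lemma adjmxK m n (A : 'M[C]_(m, n)) : adj (adj A) = A.
Proof. exact: trmxCK. Qed.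

Lemma adjmxM m n p (A : 'M[C]_(m, n)) (B : 'M[C]_(n, p)) :
  adj (A *m B) = adj B *m adj A.
Proof. by rewrite /adj trmx_mul map_mxM. Qed.

Lemma adjmxD m n (A B : 'M[C]_(m, n)) : adj (A + B) = adj A + adj B.
Proof. by apply/matrixP => i j; rewrite !(adjmxE, mxE) rmorphD. Qed.

Lemma adjmxB m n (A B : 'M[C]_(m, n)) : adj (A - B) = adj A - adj B.
Proof. by apply/matrixP => i j; rewrite !(adjmxE, mxE) rmorphB. Qed.

Lemma adjmxZ m n (c : C) (A : 'M[C]_(m, n)) : adj (c *: A) = c^*%R *: adj A.
Proof. by apply/matrixP => i j; rewrite !(adjmxE, mxE) rmorphM. Qed.

Lemma adjmx0 m n : adj (0 : 'M[C]_(m, n)) = 0.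
Proof. by apply/matrixP => i j; rewrite !(adjmxE, mxE) rmorph0. Qed.

Lemma adj_diag n (d : 'rV[C]_n) : adj (diag_mx d) = diag_mx (\row_j (d 0 j)^*%R).
Proof.
apply/matrixP => i j; rewrite adjmxE !mxE eq_sym.
by case: eqP => [->|_]; rewrite ?mulr1n ?mulr0n ?rmorph0.
Qed.

Lemma adj_delta m n i j : adj (delta_mx i j : 'M[C]_(m, n)) = delta_mx j i.
Proof. by apply/matrixP => a b; rewrite adjmxE !mxE conjC_nat andbC. Qed.

Lemma tr_adj n (A : 'M[C]_n) : \tr (adj A) = (\tr A)^*%R.
Proof. by rewrite /mxtrace rmorph_sum; apply: eq_bigr => i _; rewrite adjmxE. Qed.

Lemma ReD (a b : C) : complex.Re (a + b) = complex.Re a + complex.Re b.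
Proof. by case: a; case: b. Qed.

Lemma Re_conj (a : C) : complex.Re a^*%R = complex.Re a.
Proof. by case: a. Qed.

Lemma Re_sum (I : finType) (F : I -> C) :
  complex.Re (\sum_i F i) = \sum_i complex.Re (F i).
Proof. by apply: (big_morph _ ReD). Qed.

Lemma ReZ (c : R) (a : C) : complex.Re (c%:C%C * a) = c * complex.Re a.
Proof. by case: a => a b; rewrite /= mul0r subr0. Qed.

Lemma RC_ge0 (a : C) : 0 <= a -> (complex.Re a)%:C%C = a.
Proof. by move=> a0; rewrite RRe_real ?ger0_real. Qed.

Lemma Re_ge0 (a : C) : 0 <= a -> 0 <= complex.Re a.
Proof. by rewrite lecE => /andP[]. Qed.

End Adjoint.

(** * Frobenius norm and contractions *)

Section Frobenius.
Context {R : realType}.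
Local Notation C := R[i].
Implicit Types m n p : nat.

Definition sqfrob m n (A : 'M[C]_(m, n)) : R := complex.Re (\tr (adj A *m A)).

Lemma tr_adj_mul_ge0 m n (A : 'M[C]_(m, n)) : 0 <= \tr (adj A *m A).
Proof.
apply: sumr_ge0 => i _; rewrite mxE; apply: sumr_ge0 => j _.
by rewrite adjmxE mulrC mul_conjC_ge0.
Qed.

Lemma sqfrob_ge0 m n (A : 'M[C]_(m, n)) : 0 <= sqfrob A.
Proof. exact/Re_ge0/tr_adj_mul_ge0. Qed.

Lemma adj_mul_eq0 m n (A : 'M[C]_(m, n)) : \tr (adj A *m A) = 0 -> A = 0.
Proof.
have H i j : 0 <= adj A i j * A j i by rewrite adjmxE mulrC mul_conjC_ge0.
move=> tr0; apply/matrixP => i j.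
have /(_ j isT) : forall k, true -> (adj A *m A) k k = 0.
  apply/psumr_eq0P => // k _; rewrite mxE; exact: sumr_ge0.
rewrite mxE => s0.
have /(_ i isT) : forall k, true -> adj A j k * A k j = 0.
  by apply/psumr_eq0P.
by move/eqP; rewrite adjmxE mulrC mul_conjC_eq0 !mxE => /eqP.
Qed.

Lemma sqfrobE m n (A : 'M[C]_(m, n)) : (sqfrob A)%:C%C = \tr (adj A *m A).
Proof. exact/RC_ge0/tr_adj_mul_ge0. Qed.

Lemma sqfrob_eq0 m n (A : 'M[C]_(m, n)) : sqfrob A = 0 -> A = 0.
Proof. by move=> A0; apply: adj_mul_eq0; rewrite -sqfrobE A0. Qed.

Lemma sqfrobZ m n (c : C) (A : 'M[C]_(m, n)) :
  sqfrob (c *: A) = (complex.Re `|c|) ^+ 2 * sqfrob A.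
Proof.
rewrite /sqfrob adjmxZ -scalemxAl -scalemxAr scalerA mxtraceZ.
rewrite [_ * c]mulrC -normCK.
by rewrite -[`|c|]RC_ge0 // expr2 -mulrA !ReZ mulrA -expr2.
Qed.

Lemma vnormE n (x : 'cV[C]_n) : vnorm x = Num.sqrt (sqfrob x).
Proof. by rewrite /vnorm /sqfrob trace_mx11. Qed.

Lemma vnorm1 n (x : 'cV[C]_n) : vnorm x = 1 -> sqfrob x = 1.
Proof.
move=> x1; rewrite -[LHS]sqr_sqrtr ?sqfrob_ge0 // -vnormE x1; exact: expr1n.
Qed.

Lemma tr_adj_mul_sym m n (A B : 'M[C]_(m, n)) :
  complex.Re (\tr (adj A *m B)) = complex.Re (\tr (adj B *m A)).
Proof. by rewrite -Re_conj -tr_adj adjmxM adjmxK. Qed.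

(** Expansion of |A - B|^2 >= 0 in the Frobenius norm; this AM-GM bound stands in for Cauchy-Schwarz
    in the trace estimates. *)
Lemma tr_adj_mul_le m n (A B : 'M[C]_(m, n)) :
  complex.Re (\tr (adj A *m B)) *+ 2 <= sqfrob A + sqfrob B.
Proof.
rewrite -subr_ge0; suff -> : sqfrob A + sqfrob B
    - complex.Re (\tr (adj A *m B)) *+ 2 = sqfrob (A - B).
  exact: sqfrob_ge0.
rewrite {3}/sqfrob adjmxB mulmxBl !mulmxBr !raddfB /= (tr_adj_mul_sym B A).
rewrite /sqfrob; ring.
Qed.

(* Equivalent to operator norm at most 1; the Frobenius form lets trace
   estimates reduce to AM-GM on matrices. *)
Definition contraction n (W : 'M[C]_n) :=
  forall X : 'M[C]_n, sqfrob (W *m X) <= sqfrob X.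

Lemma sqfrob_isometry m n p (U : 'M[C]_(m, n)) (X : 'M[C]_(n, p)) :
  adj U *m U = 1%:M -> sqfrob (U *m X) = sqfrob X.
Proof. by move=> UU; rewrite /sqfrob adjmxM mulmxA -(mulmxA _ _ U) UU mulmx1. Qed.

Lemma contraction_unitary n (U : 'M[C]_n) : adj U *m U = 1%:M -> contraction U.
Proof. by move=> UU X; rewrite sqfrob_isometry. Qed.

Lemma contractionM n (V W : 'M[C]_n) :
  contraction V -> contraction W -> contraction (V *m W).
Proof. by move=> cV cW X; rewrite -mulmxA; apply: le_trans (cV _) (cW _). Qed.

Lemma contraction0 n : contraction (0 : 'M[C]_n).
Proof.
by move=> X; rewrite mul0mx {1}/sqfrob mulmx0 mxtrace0 sqfrob_ge0.
Qed.

Lemma sqfrob_sum k n (Cs : 'I_k -> 'M[C]_n) (X : 'M[C]_n) :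
  \sum_(i < k) adj (Cs i) *m Cs i = 1%:M ->
  \sum_(i < k) sqfrob (Cs i *m X) = sqfrob X.
Proof.
move=> C1; rewrite /sqfrob -Re_sum -raddf_sum /=; congr (complex.Re (\tr _)).
rewrite -[X in _ = _ *m X]mul1mx -C1 mulmx_suml mulmx_sumr.
by apply: eq_bigr => i _; rewrite adjmxM !mulmxA.
Qed.

(* With Z = (\sum_i C_i^* W_i C_i) X, expand |Z|^2 = \sum_i <C_i Z, W_i C_i X>
   and bound each term by AM-GM, to get 2|Z|^2 <= |Z|^2 + |X|^2. *)
Lemma contraction_sum k n (Cs Ws : 'I_k -> 'M[C]_n) :
  \sum_(i < k) adj (Cs i) *m Cs i = 1%:M ->
  (forall i, contraction (Ws i)) ->
  contraction (\sum_(i < k) adj (Cs i) *m Ws i *m Cs i).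
Proof.
move=> C1 cW X; set Z := _ *m X.
suff : sqfrob Z *+ 2 <= sqfrob Z + sqfrob X by rewrite mulr2n lerD2l.
rewrite -(sqfrob_sum Z C1) -(sqfrob_sum X C1) -big_split /=.
rewrite (sqfrob_sum Z C1).
rewrite {1}/sqfrob {2}/Z mulmxA mulmx_sumr mulmx_suml [\tr _]raddf_sum.
rewrite Re_sum -sumrMnl.
apply: ler_sum => i _.
apply: (@le_trans _ _ (sqfrob (Cs i *m Z) + sqfrob (Ws i *m (Cs i *m X)))).
  by apply: le_trans (tr_adj_mul_le _ _); rewrite adjmxM !mulmxA.
by rewrite lerD2l cW.
Qed.

(** As x is a unit vector, |x y^* X| = |y^* X|. AM-GM applied to |y^* X|^2 = <y y^* X, X>, with |y
    y^* X| = |y^* X|, bounds this by |X|. *)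
Lemma contraction_rank1 n (x y : 'cV[C]_n) :
  sqfrob x = 1 -> sqfrob y = 1 -> contraction (x *m adj y).
Proof.
have unit_adj (z : 'cV[C]_n) : sqfrob z = 1 -> adj z *m z = 1%:M.
  move=> z1; rewrite [LHS]mx11_scalar; congr (_%:M).
  by rewrite -trace_mx11 -sqfrobE z1.
move=> /unit_adj xx /unit_adj yy X; rewrite -mulmxA sqfrob_isometry //.
suff : sqfrob (adj y *m X) *+ 2 <= sqfrob (adj y *m X) + sqfrob X.
  by rewrite mulr2n lerD2l.
rewrite -{2}(sqfrob_isometry (adj y *m X) yy).
by apply: le_trans (tr_adj_mul_le _ _); rewrite /sqfrob !adjmxM !mulmxA.
Qed.

End Frobenius.

(** * Positive semidefinite matrices, square roots and polar decomposition *)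

Section Polar.
Context {R : realType}.
Local Notation C := R[i].
Variable n : nat.
Implicit Types A P : 'M[C]_n.

(** Polarization: the sesquilinear form [f] of P - P^* vanishes on the diagonal because x^* P x is
    real, and evaluating it at x + y and x + iy forces it to vanish everywhere. *)
Lemma psd_hermitian P : psdmx P -> adj P = P.
Proof.
move=> psdP; pose f (x y : 'cV[C]_n) := (adj x *m (P - adj P) *m y) 0 0.
have fxx x : f x x = 0.
  rewrite /f mulmxBr mulmxBl [LHS]mxE [X in _ + X]mxE; apply/eqP.
  have -> : adj x *m adj P *m x = adj (adj x *m P *m x).
    by rewrite !adjmxM adjmxK mulmxA.
  by rewrite adjmxE subr_eq0 eq_sym; apply/eqP/CrealP/ger0_real/psdP.
have fDl x y z : f (x + y) z = f x z + f y z.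
  by rewrite /f adjmxD !mulmxDl [LHS]mxE.
have fDr x y z : f x (y + z) = f x y + f x z.
  by rewrite /f mulmxDr [LHS]mxE.
have fZl c x y : f (c *: x) y = c^*%R * f x y.
  by rewrite /f adjmxZ -!scalemxAl [LHS]mxE.
have fZr c x y : f x (c *: y) = c * f x y.
  by rewrite /f -scalemxAr [LHS]mxE.
have fxy x y : f x y = 0.
  have := fxx (x + y); have := fxx (x + 'i *: y).
  rewrite !(fDl, fDr, fZl, fZr) !fxx conjCi !mulr0 !addr0 !add0r mulNr.
  move/eqP; rewrite -mulrBr mulf_eq0 (negPf (neq0Ci _)) /= subr_eq0 => /eqP ->.
  by rewrite -mulr2n => /eqP; rewrite mulrn_eq0 /= => /eqP.
apply/esym/eqP; rewrite -subr_eq0; apply/eqP/matrixP => i j.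
have := fxy (delta_mx i 0) (delta_mx j 0).
by rewrite /f adj_delta -rowE -colE !mxE.
Qed.

Lemma psd_diag_ge0 P i : psdmx P -> 0 <= P i i.
Proof.
move=> /(_ (delta_mx i 0)).
by rewrite adj_delta -rowE -colE !mxE.
Qed.

Lemma psd_congr P A : psdmx P -> psdmx (adj A *m P *m A).
Proof. by move=> psdP x; have := psdP (A *m x); rewrite adjmxM !mulmxA. Qed.

Lemma psd_adj_mul A : psdmx (adj A *m A).
Proof.
by move=> x; rewrite -trace_mx11 mulmxA -adjmxM -mulmxA tr_adj_mul_ge0.
Qed.

Lemma normal_diag A : A *m adj A = adj A *m A ->
  exists (Q : 'M[C]_n) (d : 'rV[C]_n),
    [/\ adj Q *m Q = 1%:M, Q *m adj Q = 1%:M & A = adj Q *m diag_mx d *m Q].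
Proof.
move=> nA; have /orthomx_spectralP : A \is normalmx by apply/normalmxP.
have uQ := spectral_unitarymx A; rewrite invmx_unitary // => eA.
exists (spectralmx A), (spectral_diag A); split=> //; last exact/unitarymxP.
by apply: mulmx1C; apply/unitarymxP.
Qed.

(** Diagonalize P and take square roots of the eigenvalues, which are nonnegative as diagonal
    entries of Q P Q^*. *)
Lemma psd_sqrt P : psdmx P -> exists2 S, psdmx S & S *m S = P.
Proof.
move=> psdP; have hP := psd_hermitian psdP.
have /normal_diag [Q [d [QQ QQ' eP]]] : P *m adj P = adj P *m P by rewrite hP.
have d0 i : 0 <= d 0 i.
  have := psd_diag_ge0 i (psd_congr (adj Q) psdP).
  by rewrite adjmxK eP !mulmxA QQ' mul1mx -mulmxA QQ' mulmx1 !mxE eqxx.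
pose D := diag_mx (\row_j sqrtC (d 0 j)).
have DD : D *m D = diag_mx d.
  rewrite mulmx_diag; congr diag_mx; apply/rowP => j.
  by rewrite !mxE -expr2 sqrtCK.
exists (adj Q *m D *m Q); last first.
  by rewrite -!mulmxA (mulmxA Q) QQ' mul1mx (mulmxA D) DD mulmxA.
apply: psd_congr => x; rewrite -mulmxA mxE; apply: sumr_ge0 => i _.
rewrite adjmxE mul_diag_mx !mxE mulrCA mulr_ge0 ?sqrtC_ge0 //.
by rewrite mulrC mul_conjC_ge0.
Qed.

Lemma singular_unit_ker A : A \notin unitmx ->
  exists2 x : 'cV[C]_n, adj x *m x = 1%:M & A *m x = 0.
Proof.
(* [kermx] consists of row vectors killed from the left, so a column killed by A is obtained as the
   transpose of a row killing A^T. *)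
move=> sA; have /rowV0Pn[v vA v0] : kermx A^T != 0.
  by rewrite kermx_eq0 row_free_unit unitmx_tr.
have Av : A *m v^T = 0.
  by apply: trmx_inj; rewrite trmx_mul trmxK (sub_kermxP vA) trmx0.
pose t := sqfrob v^T.
have t0 : t != 0.
  apply: contra v0 => /eqP /sqfrob_eq0 /(congr1 trmx).
  by rewrite trmxK trmx0 => ->.
exists ((Num.sqrt t)^-1%:C%C *: v^T); last by rewrite -scalemxAr Av scaler0.
rewrite adjmxZ -scalemxAl -scalemxAr scalerA [adj _ *m _]mx11_scalar -trace_mx11.
rewrite -sqfrobE -/t scale_scalar_mx; congr (_%:M).
have -> : ((Num.sqrt t)^-1%:C%C)^*%R = (Num.sqrt t)^-1%:C%C :> C.
  exact: conjc_real.
rewrite -!rmorphM /= -invfM -expr2 sqr_sqrtr ?sqfrob_ge0 // mulVf //.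
Qed.

(* If P is singular, so is A; adding y x^* to A and x x^* to P, with x and y
   unit vectors in ker P and ker A^*, keeps A^* A = P^2 and raises rank P,
   until P is invertible and U = A P^-1. *)
Lemma polar A P : adj P = P -> P *m P = adj A *m A ->
  exists2 U, adj U *m U = 1%:M & A = U *m P.
Proof.
have [k] := ubnP (n - \rank P); elim: k A P => // k IHk A P rkP hP PPAA.
have [uP|sP] := boolP (P \in unitmx).
  exists (A *m invmx P); last by rewrite mulmxKV.
  have -> : adj (A *m invmx P) = invmx P *m adj A.
    rewrite adjmxM; congr (_ *m _); apply: (can_inj (mulmxK uP)).
    by rewrite mulVmx // -{2}hP -adjmxM mulmxV // /adj trmx1 map_mx1.
  by rewrite mulmxA -(mulmxA _ _ A) -PPAA mulKmx // mulmxV.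
have sA : adj A \notin unitmx.
  apply: contra sP => uA; have : A \in unitmx.
    by rewrite -(adjmxK A) /adj map_unitmx unitmx_tr.
  by rewrite -[P \in _]andbb -unitmx_mul PPAA unitmx_mul uA.
have [x xx Px] := singular_unit_ker sP.
have [y yy Ay] := singular_unit_ker sA.
have xP : adj x *m P = 0 by rewrite -hP -adjmxM Px adjmx0.
have yA : adj y *m A = 0 by rewrite -(adjmxK A) -adjmxM Ay adjmx0.
(* |A x|^2 = x^* P^2 x = 0. *)
have Ax : A *m x = 0.
  apply/adj_mul_eq0; rewrite adjmxM -mulmxA (mulmxA (adj A)) -PPAA.
  by rewrite -mulmxA Px !mulmx0 mxtrace0.
pose P' := P + x *m adj x; pose A' := A + y *m adj x.
have eP : P = (1%:M - x *m adj x) *m P'.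
  rewrite mulmxBl mul1mx mulmxDr -mulmxA xP mulmx0 add0r.
  by rewrite mulmxA -(mulmxA x) xx mulmx1 addrK.
have eP' : P = P' *m (1%:M - x *m adj x).
  rewrite mulmxBr mulmx1 mulmxDl mulmxA Px mul0mx add0r.
  by rewrite mulmxA -(mulmxA x) xx mulmx1 addrK.
have eA' : A = A' *m (1%:M - x *m adj x).
  rewrite mulmxBr mulmx1 mulmxDl mulmxA Ax mul0mx add0r.
  by rewrite mulmxA -(mulmxA y) xx mulmx1 addrK.
have [|||U UU eA] := IHk A' P'.
- have ltP : (P < P')%MS.
    rewrite ltmxE eP submxMl /=; apply/negP => le_P'.
    (* The row x^* = x^* P' lies in the row space of P', hence by [le_P'] in that of P; but x^* = w
       P would give 1 = x^* x = w P x = 0. *)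
    have /submxP [w ew] : (adj x <= P)%MS.
      rewrite eP; apply: submx_trans le_P'.
      rewrite (_ : adj x = adj x *m P') ?submxMl //.
      by rewrite mulmxDr xP add0r mulmxA xx mul1mx.
    move: xx; rewrite ew -mulmxA Px mulmx0 => /matrixP /(_ 0 0) /eqP.
    by rewrite !mxE eq_sym oner_eq0.
  have := ltmxErank P P'; rewrite ltP => /esym /andP[_ lt_rk].
  have := rank_leq_row P'; lia.
- by rewrite adjmxD adjmxM adjmxK hP.
- rewrite adjmxD adjmxM adjmxK !mulmxDl !mulmxDr !mulmxA PPAA.
  rewrite Px Ay -!(mulmxA x (adj x)) -!(mulmxA x (adj y)) xP yA xx yy.
  by rewrite !mul0mx !mulmx0.
(* With E = 1 - x x^* the projection killing x, A = A' E = U P' E = U P. *)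
exists U => //; by rewrite [in LHS]eA' eA -mulmxA -eP'.
Qed.

End Polar.

(** * Trace norm: duality with contractions, L-norm property and comparison with the operator
    norm *)

Section TraceNorm.
Context {R : realType}.
Local Notation C := R[i].
Variable n : nat.
Implicit Types A P : 'M[C]_n.

(** Write A = U P and P = S^2 with S hermitian. In Frobenius norms, Re Tr(W A) = Re <S, W U S> is at
    most (|S|^2 + |W U S|^2)/2 <= |S|^2 = Tr P. *)
Lemma trnorm_bound A P W : psdmx P -> P *m P = adj A *m A -> contraction W ->
  complex.Re (\tr (W *m A)) <= complex.Re (\tr P).
Proof.
move=> psdP PPAA cW; have [U UU ->] := polar (psd_hermitian psdP) PPAA.
have [S /psd_hermitian hS <-] := psd_sqrt psdP.
have cWU : contraction (W *m U) by apply/contractionM/contraction_unitary.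
rewrite !mulmxA mxtrace_mulC.
have -> : complex.Re (\tr (S *m S)) = sqfrob S by rewrite /sqfrob hS.
have := tr_adj_mul_le S (W *m U *m S); have := cWU S.
by rewrite hS mulr2n !mulmxA; lra.
Qed.

(** A root exists by [psd_sqrt], so [xget] never falls back on its default 0. *)
Lemma absmxP A : psdmx (absmx A) /\ absmx A *m absmx A = adj A *m A.
Proof.
rewrite /absmx; case: xgetP => [P _ //|noP].
have [P psdP PP] := psd_sqrt (psd_adj_mul A).
by case: (noP P).
Qed.

Lemma contraction_trnorm A W : contraction W ->
  complex.Re (\tr (W *m A)) <= trnorm A.
Proof. by have [] := absmxP A; exact: trnorm_bound. Qed.

(** The adjoint of the polar factor works: A = U P gives U^* A = P. *)
Lemma trnorm_attained A P : psdmx P -> P *m P = adj A *m A ->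
  exists2 U, adj U *m U = 1%:M & \tr (U *m A) = \tr P.
Proof.
move=> psdP PPAA; have [U UU ->] := polar (psd_hermitian psdP) PPAA.
by exists (adj U); rewrite ?adjmxK ?mulmxA ?UU ?mul1mx //; exact: mulmx1C.
Qed.

Lemma trnorm_unitary A :
  exists2 U, adj U *m U = 1%:M & complex.Re (\tr (U *m A)) = trnorm A.
Proof.
have [psdP PPAA] := absmxP A; have [U UU trU] := trnorm_attained psdP PPAA.
by exists U; rewrite // trU.
Qed.

(** The trace of any positive semidefinite root of A^* A is the same maximum of Re Tr(W A) over
    contractions W. This replaces uniqueness of the root. *)
Lemma trnorm_eq A P : psdmx P -> P *m P = adj A *m A ->
  trnorm A = complex.Re (\tr P).
Proof.
move=> psdP PPAA; apply: le_anti; apply/andP; split.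
  have [U UU <-] := trnorm_unitary A.
  exact/trnorm_bound/contraction_unitary.
have [U UU <-] := trnorm_attained psdP PPAA.
exact/contraction_trnorm/contraction_unitary.
Qed.

Lemma trnorm_ge0 A : 0 <= trnorm A.
Proof.
by have := contraction_trnorm A (@contraction0 R n); rewrite mul0mx mxtrace0.
Qed.

Lemma trnormD A B : trnorm (A + B) <= trnorm A + trnorm B.
Proof.
have [U UU <-] := trnorm_unitary (A + B).
rewrite mulmxDr mxtraceD ReD lerD // contraction_trnorm //;
  exact: contraction_unitary.
Qed.

Lemma trnormZ (c : C) A : trnorm (c *: A) = complex.Re `|c| * trnorm A.
Proof.
have [psdP PPAA] := absmxP A.
rewrite [in RHS]/trnorm -ReZ RC_ge0 // -mxtraceZ; apply: trnorm_eq.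
  move=> x; rewrite -scalemxAr -scalemxAl mxE mulr_ge0 //; exact: psdP.
rewrite adjmxZ -!scalemxAl -!scalemxAr !scalerA PPAA.
by rewrite -expr2 normCK mulrC.
Qed.

Lemma vnorm_mul_le_trnorm A (x : 'cV[C]_n) : vnorm x = 1 ->
  vnorm (A *m x) <= trnorm A.
Proof.
move=> /vnorm1 x1; set v := vnorm _.
have [->|v0] := eqVneq v 0; first exact: trnorm_ge0.
have vv : v ^+ 2 = sqfrob (A *m x) by rewrite /v vnormE sqr_sqrtr ?sqfrob_ge0.
(* The test contraction is W = x y^* with y = A x / |A x|, for which Tr(W A) = y^* A x = |A x|. *)
pose y := v^-1%:C%C *: (A *m x).
have v_ge0 : 0 <= v by rewrite /v vnormE sqrtr_ge0.
have y1 : sqfrob y = 1.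
  rewrite /y sqfrobZ -vv normc_def /= expr0n addr0 sqrtr_sqr.
  rewrite ger0_norm ?invr_ge0 //.
  by rewrite exprVn mulVf // expf_neq0.
apply: le_trans (contraction_trnorm A (contraction_rank1 x1 y1)).
rewrite -mulmxA mxtrace_mulC /y adjmxZ -!scalemxAl mxtraceZ.
have -> : (v^-1%:C%C)^*%R = v^-1%:C%C :> C by exact: conjc_real.
by rewrite ReZ -mulmxA -/(sqfrob (A *m x)) -vv expr2 mulKf.
Qed.

(** A real [sup] dominates its set only once that set is known to be bounded; the trace norm
    supplies the bound. *)
Lemma opnorm_ge A (x : 'cV[C]_n) : vnorm x = 1 -> vnorm (A *m x) <= opnorm A.
Proof.
move=> x1; apply: ub_le_sup; last by exists x.
by exists (trnorm A) => _ [z z1 <-]; exact: vnorm_mul_le_trnorm.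
Qed.

Lemma opnorm_le_trnorm A : opnorm A <= trnorm A.
Proof.
have [[x x1]|no] := pselect (exists x : 'cV[C]_n, vnorm x = 1).
  apply: ge_sup; first by exists (vnorm (A *m x)), x.
  by move=> _ [z z1 <-]; exact: vnorm_mul_le_trnorm.
(* Without unit vectors, that is for n = 0, [opnorm] is the supremum of the empty set, which is 0 by
   convention. *)
rewrite /opnorm (_ : image _ _ = set0) ?sup0 ?trnorm_ge0 //.
by apply/seteqP; split=> // t [x x1 _]; apply: no; exists x.
Qed.

Lemma trnorm_eq0 A : trnorm A = 0 -> A = 0.
Proof.
move=> A0; apply/matrixP => i j; rewrite [RHS]mxE.
have v1 : vnorm (delta_mx j 0 : 'cV[C]_n) = 1.
  by rewrite /vnorm adj_delta mul_delta_mx mxE eqxx sqrtr1.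
have := vnorm_mul_le_trnorm A v1; rewrite A0 vnormE => le0.
have /sqfrob_eq0 Ae0 : sqfrob (A *m (delta_mx j 0 : 'cV[C]_n)) = 0.
  apply: le_anti; rewrite sqfrob_ge0 andbT -sqrtr_eq0; apply/eqP/le_anti.
  by rewrite le0 sqrtr_ge0.
by have /matrixP/(_ i 0) := Ae0; rewrite -colE !mxE.
Qed.

Lemma trnorm_is_norm : is_norm (@trnorm R n).
Proof.
by split; [exact: trnorm_ge0|exact: trnorm_eq0|exact: trnormZ|exact: trnormD].
Qed.

(** By cyclicity, Tr(U_i C_i A C_i^* ) = Tr(C_i^* U_i C_i A), so the sum of the attained maxima is a
    single trace of A against a contraction. *)
Lemma trnorm_Lineq k (Cs : 'I_k -> 'M[C]_n) A :
  \sum_(i < k) adj (Cs i) *m Cs i = 1%:M ->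
  \sum_(i < k) trnorm (Cs i *m A *m adj (Cs i)) <= trnorm A.
Proof.
move=> C1; have /choice[U UP] i : exists U, adj U *m U = 1%:M /\
    complex.Re (\tr (U *m (Cs i *m A *m adj (Cs i))))
      = trnorm (Cs i *m A *m adj (Cs i)).
  by have [U] := trnorm_unitary (Cs i *m A *m adj (Cs i)); exists U.
have cU : contraction (\sum_(i < k) adj (Cs i) *m U i *m Cs i).
  by apply: contraction_sum => // i; apply: contraction_unitary; case: (UP i).
apply: le_trans (contraction_trnorm A cU).
rewrite mulmx_suml [\tr _]raddf_sum Re_sum; apply: ler_sum => i _.
by have [_ <-] := UP i; rewrite mulmxA mxtrace_mulC !mulmxA.
Qed.

Lemma trnorm_is_Lnorm : is_Lnorm (@trnorm R n).
Proof. by split; [exact: trnorm_is_norm|move=> *; exact: trnorm_Lineq]. Qed.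

Lemma trnorm_le_sum_opnorm A : exists2 Cs : 'I_n -> 'M[C]_n,
  \sum_(i < n) adj (Cs i) *m Cs i = 1%:M &
  trnorm A <= \sum_(i < n) opnorm (Cs i *m A *m adj (Cs i)).
Proof.
have [U UU <-] := trnorm_unitary A.
have [|Q [d [QQ QQ' eU]]] := @normal_diag R n U; first by rewrite UU; exact: mulmx1C.
(* As U = Q^* D Q, the adjoints of the rows of Q are the eigenvectors of U. *)
pose e i := adj (row i Q); pose Cs i := e i *m adj (e i).
have ee i : adj (e i) *m e i = 1%:M.
  rewrite /e adjmxK; apply/matrixP => a b; rewrite !ord1 mxE.
  have := congr1 (fun M : 'M_n => M i i) QQ'; rewrite !mxE eqxx => <-.
  by apply: eq_bigr => k _; rewrite !adjmxE mxE.
have CC i : adj (Cs i) *m Cs i = Cs i.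
  by rewrite /Cs adjmxM adjmxK mulmxA -(mulmxA (e i)) ee mulmx1.
have dd i : `|d 0 i| = 1.
  have eD : diag_mx d = Q *m U *m adj Q.
    by rewrite eU -!mulmxA QQ' mulmx1 mulmxA QQ' mul1mx.
  have : adj (diag_mx d) *m diag_mx d = 1%:M.
    rewrite eD !adjmxM adjmxK -!mulmxA (mulmxA (adj Q)) QQ mul1mx.
    by rewrite (mulmxA (adj U)) UU mul1mx.
  move/matrixP/(_ i i); rewrite adj_diag mulmx_diag !mxE eqxx !mulr1n => dd1.
  by apply/eqP; rewrite -(@pexpr_eq1 _ _ 2) // normCKC dd1.
exists Cs.
  rewrite (eq_bigr _ (fun i _ => CC i)) -QQ; apply/matrixP => a b.
  rewrite summxE mxE; apply: eq_bigr => i _.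
  by rewrite mxE big_ord1 /e adjmxK !adjmxE !mxE.
have -> : \tr (U *m A) = \sum_i d 0 i * \tr (adj (e i) *m A *m e i).
  rewrite eU -!mulmxA mxtrace_mulC -!mulmxA /mxtrace; apply: eq_bigr => i _.
  rewrite mul_diag_mx mxE big_ord1. congr (_ * _).
  rewrite /e adjmxK mulmxA mxE [RHS]mxE; apply: eq_bigr => j _.
  by rewrite -row_mul !adjmxE [row i Q _ _]mxE [row i _ _ _]mxE.
rewrite Re_sum; apply: ler_sum => i _; set a := \tr _.
have aE : adj (e i) *m A *m e i = a%:M by rewrite [LHS]mx11_scalar -trace_mx11.
have e1 : vnorm (e i) = 1 by rewrite /vnorm ee mxE eqxx sqrtr1.
(* Testing C_i A C_i^* at the unit vector e_i gives |a|, where a = <A e_i, e_i>, because e_i is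
   mapped to a e_i. *)
apply: le_trans (opnorm_ge _ e1).
have -> : Cs i *m A *m adj (Cs i) *m e i = a *: e i.
  rewrite /Cs adjmxM adjmxK -!mulmxA ee mulmx1 !mulmxA -mulmxA -mulmxA.
  by rewrite (mulmxA (adj _)) aE mul_mx_scalar.
rewrite vnormE sqfrobZ (vnorm1 e1) mulr1 sqrtr_sqr.
rewrite -[`|a|]mul1r -(dd i) -normrM.
apply: le_trans (ler_norm _).
apply: le_trans (ler_norm _) _.
by have := normc_ge_Re (d 0 i * a); rewrite lecE => /andP[].
Qed.

End TraceNorm.

Theorem theorem3p3 (R : realType) (n : nat) :
  (forall A : 'M[R[i]]_n,
     ((trnorm A)%:E =
      ereal_sup [set s : \bar R | exists (k : nat) (Cs : 'I_k -> 'M[R[i]]_n),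
                   \sum_(i < k) adj (Cs i) *m Cs i = 1%:M /\
                   s = (\sum_(i < k) opnorm (Cs i *m A *m adj (Cs i)))%:E])%classic)
  /\
  ((is_Lnorm (@trnorm R n) /\ (forall X : 'M[R[i]]_n, opnorm X <= trnorm X))
   /\ forall N : 'M[R[i]]_n -> R,
        is_Lnorm N -> (forall X, opnorm X <= N X) ->
        forall X, trnorm X <= N X).
Proof.
split=> [A|].
  apply: le_anti; apply/andP; split.
    (* The n rank-one eigenprojections give this direction; the other is the L-norm inequality of
       the trace norm, which dominates the operator norm. *)
    have [Cs C1 le_tr] := trnorm_le_sum_opnorm A.
    apply: le_trans (ereal_sup_ubound _); last by exists n, Cs.
    by rewrite lee_fin.
  apply: ge_ereal_sup => _ [k [Cs [C1 ->]]]; rewrite lee_fin.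
  apply: le_trans (trnorm_Lineq A C1).
  by apply: ler_sum => i _; exact: opnorm_le_trnorm.
split; first by split; [exact: trnorm_is_Lnorm|exact: opnorm_le_trnorm].
move=> N [_ LN] leN X; have [Cs C1 le_tr] := trnorm_le_sum_opnorm X.
apply: le_trans le_tr _; apply: le_trans (LN _ _ X C1).
by apply: ler_sum => i _; exact: leN.
Qed.
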